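(* Let $\Theta=(J_3,J_5,\alpha,\beta)$ be a Jacobi-type pencil, where $J_3$ has entries $a_k>0$, $b_k\in\mathbb{R}$ and $J_5$ has entries $\alpha_k,\beta_k\in\mathbb{R}$, $\gamma_k>0$ ($k\in\mathbb{Z}_+$), and let $\{p_n(\lambda)\}_{n=0}^\infty$ be the associated polynomials of $\Theta$. For arbitrary $n\in\mathbb{N}$ and $\lambda,y\in\mathbb{C}$ with $\lambda\neq y$, $$\sum_{k=0}^n\bigl(a_{k-1}p_{k-1}(y)+b_kp_k(y)+a_kp_{k+1}(y)\bigr)p_k(\lambda)$$ $$=\gamma_{n-1}\frac{p_{n+1}(\lambda)p_{n-1}(y)-p_{n+1}(y)p_{n-1}(\lambda)}{\lambda-y}+\gamma_n\frac{p_{n+2}(\lambda)p_n(y)-p_{n+2}(y)p_n(\lambda)}{\lambda-y}$$ $$+(\beta_n-a_n\lambda)\frac{p_{n+1}(\lambda)p_n(y)-p_{n+1}(y)p_n(\lambda)}{\lambda-y},$$ where $a_{-1}=0$ and $p_{-1}=0$.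
   Context: $\mathbb{Z}_+$ denotes the non-negative integers and $\mathbb{N}$ the positive integers. A Jacobi-type pencil is a tuple $\Theta=(J_3,J_5,\alpha,\beta)$, where $\alpha>0$, $\beta\in\mathbb{R}$, $J_3$ is a semi-infinite real symmetric tridiagonal (Jacobi) matrix, rows and columns indexed by $\mathbb{Z}_+$, with diagonal entries $b_0,b_1,\ldots\in\mathbb{R}$ and entries $(J_3)_{k,k+1}=(J_3)_{k+1,k}=a_k>0$, and $J_5$ is a semi-infinite real symmetric five-diagonal matrix with diagonal entries $\alpha_k\in\mathbb{R}$, $(J_5)_{k,k+1}=(J_5)_{k+1,k}=\beta_k\in\mathbb{R}$, $(J_5)_{k,k+2}=(J_5)_{k+2,k}=\gamma_k>0$, $k\in\mathbb{Z}_+$. Associated polynomials of $\Theta$: the unique system $\{p_n(\lambda)\}_{n=0}^\infty$ with $p_0(\lambda)=1$, $p_1(\lambda)=\alpha\lambda+\beta$ and $(J_5-\lambda J_3)(p_0(\lambda),p_1(\lambda),\ldots)^T=0$, i.e. $$\gamma_{n-2}p_{n-2}(\lambda)+(\beta_{n-1}-\lambda a_{n-1})p_{n-1}(\lambda)+(\alpha_n-\lambda b_n)p_n(\lambda)+(\beta_n-\lambda a_n)p_{n+1}(\lambda)+\gamma_np_{n+2}(\lambda)=0,\quad n\in\mathbb{Z}_+,$$ where $p_{-2}=p_{-1}=0$ and $\gamma_{-2}=\gamma_{-1}=a_{-1}=\beta_{-1}=0$. *)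

(* Defs.v *)
From mathcomp Require Import all_boot all_order all_algebra.
From mathcomp Require Import complex reals.
From mathcomp Require Import ring.

Set Implicit Arguments.
Unset Strict Implicit.
Unset Printing Implicit Defensive.

Import Order.TTheory GRing.Theory Num.Theory.
Local Open Scope ring_scope.
Local Open Scope complex_scope.

(* Semi-infinite matrices are functions of (row, column), both ranging over
   the non-negative integers. *)
Record jacobi_pencil (R : realType) := JacobiPencil {
  J3 : nat -> nat -> R;
  J5 : nat -> nat -> R;
  alpha : R;
  beta : R;
  J3_sym : forall i j : nat, J3 i j = J3 j i;
  J3_band : forall i j : nat, (i.+1 < j)%N -> J3 i j = 0;
  J3_gt0 : forall k : nat, 0 < J3 k k.+1;
  J5_sym : forall i j : nat, J5 i j = J5 j i;
  J5_band : forall i j : nat, (i.+2 < j)%N -> J5 i j = 0;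
  J5_gt0 : forall k : nat, 0 < J5 k k.+2;
  alpha_gt0 : 0 < alpha
}.

(* The trailing underscore distinguishes the matrix entries alpha_k, beta_k
   from the scalars alpha, beta of the pencil. *)
Definition a_ (R : realType) (Th : jacobi_pencil R) (k : nat) : R :=
  J3 Th k k.+1.
Definition b_ (R : realType) (Th : jacobi_pencil R) (k : nat) : R :=
  J3 Th k k.
Definition alpha_ (R : realType) (Th : jacobi_pencil R) (k : nat) : R :=
  J5 Th k k.
Definition beta_ (R : realType) (Th : jacobi_pencil R) (k : nat) : R :=
  J5 Th k k.+1.
Definition gamma_ (R : realType) (Th : jacobi_pencil R) (k : nat) : R :=
  J5 Th k k.+2.

(* [prev_term u k] is u_{k-1}, with the convention u_{-1} = 0. *)
Definition prev_term (V : nmodType) (u : nat -> V) (k : nat) : V :=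
  if k is j.+1 then u j else 0.

(* The n-th component of (J5 - lam J3) v.  The sum stops at j = n + 2 because
   all further entries of row n are zero. *)
Definition pencil_row (R : realType) (Th : jacobi_pencil R) (lam : R[i])
    (v : nat -> R[i]) (n : nat) : R[i] :=
  \sum_(j < n.+3) ((J5 Th n j)%:C - lam * (J3 Th n j)%:C) * v j.

Definition associated_polynomials (R : realType) (Th : jacobi_pencil R)
    (p : nat -> {poly R[i]}) : Prop :=
  [/\ p 0%N = 1,
      p 1%N = (alpha Th)%:C *: 'X + ((beta Th)%:C)%:P
    & forall (lam : R[i]) (n : nat),
        pencil_row Th lam (fun j => (p j).[lam]) n = 0].

Lemma pencil_rowE (R : realType) (Th : jacobi_pencil R) (lam : R[i])
    (v : nat -> R[i]) (n : nat) :
  pencil_row Th lam v n =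
    prev_term (prev_term (fun j => (gamma_ Th j)%:C * v j)) n
    + prev_term (fun j => ((beta_ Th j)%:C - lam * (a_ Th j)%:C) * v j) n
    + ((alpha_ Th n)%:C - lam * (b_ Th n)%:C) * v n
    + ((beta_ Th n)%:C - lam * (a_ Th n)%:C) * v n.+1
    + (gamma_ Th n)%:C * v n.+2.
Proof.
have z3 : J3 Th n n.+2 = 0 by rewrite J3_band.
rewrite /pencil_row !big_ord_recr /= z3 mulr0 subr0.
do 3! congr (_ + _).
case: n z3 => [|[|n]] _; first by rewrite big_ord0 /= addr0.
  by rewrite big_ord_recr big_ord0 /= [J5 _ _ _]J5_sym [J3 _ _ _]J3_sym.
rewrite !big_ord_recr /= big1 => [|j _].
  rewrite ![J5 Th n.+2 _]J5_sym ![J3 Th n.+2 _]J3_sym [J3 Th n _]J3_band //.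
  by rewrite mulr0 subr0 add0r.
have ltj : (j.+2 < n.+2)%N by rewrite !ltnS.
by rewrite J5_sym J3_sym J5_band // J3_band ?(ltnW ltj) // mulr0 subr0 mul0r.
Qed.

Lemma associated_polynomials_exist (R : realType) (Th : jacobi_pencil R) :
  exists p : nat -> {poly R[i]}, associated_polynomials Th p.
Proof.
pose g n : R[i] := (gamma_ Th n)%:C.
pose c n : {poly R[i]} := ((beta_ Th n)%:C)%:P - (a_ Th n)%:C *: 'X.
pose d n : {poly R[i]} := ((alpha_ Th n)%:C)%:P - (b_ Th n)%:C *: 'X.
(* state at n: (gamma_{n-2} p_{n-2} + c_{n-1} p_{n-1}, gamma_{n-1} p_{n-1},
   p_n, p_{n+1}) *)
pose step n (s : {poly R[i]} * {poly R[i]} * {poly R[i]} * {poly R[i]}) :=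
  let: (u, w, x, z) := s in
  (w + c n * x, g n *: x, z, - (g n)^-1 *: (u + d n * x + c n * z)).
pose s := fix s n := if n is m.+1 then step m (s m)
  else (0, 0, 1, (alpha Th)%:C *: 'X + ((beta Th)%:C)%:P).
pose p n := (s n).1.2.
have pS n : p n.+1 = (s n).2 by rewrite /p /= /step; case: (s n) => [[[]]].
have pw n : (s n).1.1.2 = prev_term (fun j => g j *: p j) n.
  by case: n => //= n; rewrite /p /step; case: (s n) => [[[]]].
have pu n : (s n).1.1.1 = prev_term (prev_term (fun j => g j *: p j)) n
                          + prev_term (fun j => c j * p j) n.
  case: n => [|n] /=; first by rewrite addr0.
  by rewrite -pw /p /step; case: (s n) => [[[]]].
have pSS n : p n.+2 = - (g n)^-1 *: ((s n).1.1.1 + d n * p n + c n * p n.+1).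
  by rewrite pS pS /p /= /step; case: (s n) => [[[]]].
exists p; split=> // lam n; rewrite pencil_rowE pSS pu.
have gn0 : g n != 0.
  by rewrite /g eq_complex /= eqxx andbT gt_eqF // J5_gt0.
rewrite -/(g n) hornerZ mulrA mulrN mulfV // mulN1r.
have e1 : (prev_term (prev_term (fun j => g j *: p j)) n).[lam]
          = prev_term (prev_term (fun j => g j * (p j).[lam])) n.
  by case: n {gn0} => [|[|n]] /=; rewrite ?horner0 ?hornerZ.
have e2 : (prev_term (fun j => c j * p j) n).[lam]
   = prev_term (fun j => ((beta_ Th j)%:C - lam * (a_ Th j)%:C) * (p j).[lam]) n.
  by case: n {gn0 e1} => [|n] /=; rewrite ?horner0 // /c !hornerE /= [lam * _]mulrC.
by rewrite !hornerD !hornerM e1 e2 /d /c !hornerE /=; ring.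
Qed.

Lemma associated_polynomials_unique (R : realType) (Th : jacobi_pencil R)
    (p q : nat -> {poly R[i]}) :
  associated_polynomials Th p -> associated_polynomials Th q -> p =1 q.
Proof.
move=> [p0 p1 pr] [q0 q1 qr].
have ext (f h : {poly R[i]}) : (forall x, f.[x] = h.[x]) -> f = h.
  move=> fh; apply/eqP; rewrite -subr_eq0; apply/eqP.
  pose rs := [seq (i%:R : R[i]) | i <- iota 0 (size (f - h))].
  apply: (@roots_geq_poly_eq0 _ _ rs).
  - by apply/allP=> x _; rewrite /root !hornerE fh subrr.
  - rewrite map_inj_uniq ?iota_uniq // => i j /eqP.
    by rewrite eqr_nat => /eqP.
  - by rewrite size_map size_iota.
suff H n : p n = q n /\ p n.+1 = q n.+1 by move=> n; case: (H n).
elim/ltn_ind: n => -[|n] IH; first by rewrite p0 q0 p1 q1.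
split; first by case: (IH n).
apply: ext => x; have := pr x n; rewrite -(qr x n) !pencil_rowE.
have [-> ->] := IH n (ltnSn n).
have gn0 : (gamma_ Th n)%:C != 0 :> R[i].
  by rewrite eq_complex /= eqxx andbT gt_eqF // J5_gt0.
have -> : prev_term (prev_term (fun j => (gamma_ Th j)%:C * (p j).[x])) n
        = prev_term (prev_term (fun j => (gamma_ Th j)%:C * (q j).[x])) n.
  case: n IH {gn0} => [|[|n]] //= IH.
  by case: (IH n _) => [|-> _] //; rewrite !ltnS leqW.
have -> : prev_term (fun j => ((beta_ Th j)%:C - x * (a_ Th j)%:C) * (p j).[x]) n
        = prev_term (fun j => ((beta_ Th j)%:C - x * (a_ Th j)%:C) * (q j).[x]) n.
  case: n IH {gn0} => [|n] //= IH.
  by case: (IH n _) => [|-> _] //; rewrite ltnS leqW.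
by move/addrI/(mulfI gn0).
Qed.

(* Main.v *)
Require Import Defs.
From mathcomp Require Import all_boot all_order all_algebra.
From mathcomp Require Import complex reals.
From mathcomp Require Import ring.
Import Order.TTheory GRing.Theory Num.Theory.
Local Open Scope ring_scope.
Local Open Scope complex_scope.

(* Multiplying the recurrence of [u] by [v k], that of [v] by [u k] and
   subtracting shows that (x - y) times the k-th summand is a difference of
   consecutive values of the right-hand side, so the sum telescopes. *)
Lemma christoffel_darboux_rec {K : comPzRingType} {a b al be g u v : nat -> K}
    {x y : K} :
  let row z w n :=
    prev_term (prev_term (fun j => g j * w j)) n
    + prev_term (fun j => (be j - z * a j) * w j) n
    + (al n - z * b n) * w n + (be n - z * a n) * w n.+1 + g n * w n.+2 in
  (forall n, row x u n = 0) -> (forall n, row y v n = 0) ->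
  forall n,
  (x - y) * (\sum_(0 <= k < n.+1)
     (prev_term (fun j => a j * v j) k + b k * v k + a k * v k.+1) * u k)
  = prev_term (fun j => g j * (u j.+2 * v j - v j.+2 * u j)) n
    + g n * (u n.+2 * v n - v n.+2 * u n)
    + (be n - a n * x) * (u n.+1 * v n - v n.+1 * u n).
Proof.
move=> row ru rv.
have rec n : row x u n * v n - row y v n * u n = 0.
  by rewrite ru rv !mul0r subrr.
elim=> [|n IHn].
  (* Subtracting the vanishing combination [rec] from the right-hand side leaves a polynomial
     identity in which the [al] terms cancel. *)
  by rewrite big_nat1 -[RHS]subr0 -(rec 0%N) /row /=; ring.
rewrite big_nat_recr //= mulrDr IHn -[RHS]subr0 -(rec n.+1) /row /=.
(* The terms [prev_term _ n] reduce only once [n] is zero or a successor. *)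
by case: n {IHn} => [|n] /=; ring.
Qed.

Theorem theorem4 (R : realType) (Th : jacobi_pencil R)
    (p : nat -> {poly R[i]}) (hp : associated_polynomials Th p)
    (n : nat) (hn : (0 < n)%N) (lam y : R[i]) (hly : lam <> y) :
  \sum_(0 <= k < n.+1)
     (prev_term (fun j => (a_ Th j)%:C * (p j).[y]) k
      + (b_ Th k)%:C * (p k).[y]
      + (a_ Th k)%:C * (p k.+1).[y]) * (p k).[lam]
  = (gamma_ Th n.-1)%:C
      * (((p n.+1).[lam] * (p n.-1).[y] - (p n.+1).[y] * (p n.-1).[lam])
         / (lam - y))
    + (gamma_ Th n)%:C
      * (((p n.+2).[lam] * (p n).[y] - (p n.+2).[y] * (p n).[lam])
         / (lam - y))
    + ((beta_ Th n)%:C - (a_ Th n)%:C * lam)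
      * (((p n.+1).[lam] * (p n).[y] - (p n.+1).[y] * (p n).[lam])
         / (lam - y)).
Proof.
case: hp => _ _ rec.
have d0 : lam - y != 0 by rewrite subr_eq0; apply/eqP.
(* The recurrence in its expanded form, which is [row] for the values of [p] at [z]. *)
have recE z k : _ = 0 := etrans (esym (pencil_rowE _ _ _ _)) (rec z k).
apply: (mulfI d0); rewrite (christoffel_darboux_rec (recE lam) (recE y)).
(* As [0 < n], the remaining [prev_term] is the term of index [n.-1]; only the division by [lam - y]
   is left to check. *)
by case: n hn => // n _ /=; field.
Qed.
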